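(* Every $\alpha\in K$ has a unique continued fraction expansion; that is, for every $\alpha\in K$ there is exactly one finite or infinite sequence $(c_j)_{j\ge 0}$ with $c_0\in Z$ and $c_j\in Z^*$ for all $j\ge 1$ such that $\alpha=[c_0;c_1,\dots,c_n]$ (if the sequence is finite with last term $c_n$) or $\alpha=\lim_{n\to\infty}[c_0;c_1,\dots,c_n]$ in $K$ (if the sequence is infinite).
   Context: Let $p$ be a prime and let $K$ be a finite extension of $\mathbb{Q}_p$ of degree $m$, with ramification index $e$ and residue degree $f$ (so $m=ef$). Let $|\cdot|$ be the unique extension to $K$ of the $p$-adic absolute value with $|p|=p^{-1}$. Let $L\subseteq K$ be the unramified subextension of degree $f$ over $\mathbb{Q}_p$, write $L=\mathbb{Q}_p(\gamma)$ with $\gamma$ a primitive $(p^f-1)$-th root of unity, and fix $\beta\in K$ with $K=L(\beta)$ and $|\beta|=p^{1/e}$. Let $D$ be either $\{0,1,\dots,p-1\}$ or (for $p$ odd) $\{-\frac{p-1}{2},\dots,\frac{p-1}{2}\}$; the claim is made for each choice. Let $X=\{\sum_{j=0}^{k}a_jp^{-j} : k\in\mathbb{N}\cup\{0\},\ a_j\in D\}$, $Z=\{\sum_{i=0}^{e-1}\sum_{j=0}^{f-1}b_{i,j}\gamma^j\beta^i : b_{i,j}\in X\}$, and $Z^*=\{c\in Z : |c|>1\}$. Here $[c_0;c_1,\dots,c_n]=c_0+\cfrac{1}{c_1+\cfrac{1}{\ddots+\cfrac{1}{c_n}}}$. *)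

(* Defs.v *)
From HB Require Import structures.
From mathcomp Require Import all_boot all_order all_algebra all_field.
From mathcomp Require Import all_classical all_reals all_analysis.
Import Order.TTheory GRing.Theory Num.Theory.
Import numFieldNormedType.Exports.

Set Implicit Arguments.
Unset Strict Implicit.
Unset Printing Implicit Defensive.

Local Open Scope classical_set_scope.
Local Open Scope ring_scope.

Definition is_absolute_value (R : realType) (F : fieldType) (v : F -> R) :
    Prop :=
  [/\ forall x, 0 <= v x,
      forall x, v x = 0 <-> x = 0,
      forall x y, v (x * y) = v x * v y
    & forall x y, v (x + y) <= v x + v y].

Definition padic_abs_rat (R : realType) (p : nat) (q : rat) : R :=
  if q == 0 then 0
  else p%:R ^+ logn p `|denq q|%N / p%:R ^+ logn p `|numq q|%N.

Definition is_complete (R : realType) (F : fieldType) (v : F -> R) : Prop :=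
  forall u : nat -> F,
    (forall eps : R, 0 < eps -> exists N : nat,
       forall m n : nat, (N <= m)%N -> (N <= n)%N -> v (u m - u n) < eps) ->
    exists l : F, (fun n => v (u n - l)) @ \oo --> (0 : R).

(* (Qp, vp) is "the" field of p-adic numbers: a completion of rat for the
   p-adic absolute value normalised by |p| = 1/p. This determines (Qp, vp) up
   to a unique isometric isomorphism. The second clause forces characteristic
   0, so that ratr is an embedding. *)
Definition is_padic_field (R : realType) (p : nat) (Qp : fieldType)
    (vp : Qp -> R) : Prop :=
  [/\ is_absolute_value vp,
      forall q : rat, vp (ratr q) = padic_abs_rat R p q,
      forall (x : Qp) (eps : R), 0 < eps -> exists q : rat, vp (x - ratr q) < eps
    & is_complete vp].

Section Extension.
Variables (R : realType) (Qp : fieldType) (K : fieldExtType Qp).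

Definition extends_absolute_value (vp : Qp -> R) (v : K -> R) : Prop :=
  is_absolute_value v /\ forall a : Qp, v a%:A = vp a.

(* The index of the value group |Qp^*| in |E^*| is e: t is a system of
   representatives (through v) of the cosets. *)
Definition ramification_index (vp : Qp -> R) (v : K -> R) (E : {subfield K})
    (e : nat) : Prop :=
  exists t : 'I_e -> K,
    (forall i, t i \in E /\ t i != 0) /\
    forall x, x \in E -> x != 0 ->
      exists! i : 'I_e, exists a : Qp, a != 0 /\ v x = v (t i) * vp a.

(* The residue field {v <= 1} / {v < 1} of E has dimension f over the residue
   field {vp <= 1} / {vp < 1} of Qp: the residue classes of u form a basis. *)
Definition residue_degree (vp : Qp -> R) (v : K -> R) (E : {subfield K})
    (f : nat) : Prop :=
  exists u : 'I_f -> K,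
    [/\ forall i, u i \in E /\ v (u i) <= 1,
        forall x, x \in E -> v x <= 1 ->
          exists a : 'I_f -> Qp, (forall i, vp (a i) <= 1) /\
            v (x - \sum_(i < f) a i *: u i) < 1
      & forall a : 'I_f -> Qp, (forall i, vp (a i) <= 1) ->
          v (\sum_(i < f) a i *: u i) < 1 -> forall i, vp (a i) < 1].

(* Residue fields are finite here, so their extensions are separable and
   ramification index 1 is the whole condition. *)
Definition unramified (vp : Qp -> R) (v : K -> R) (E : {subfield K}) : Prop :=
  ramification_index vp v E 1.

Definition digitsX (p : nat) (D : set int) : set Qp :=
  [set x | exists (k : nat) (a : 'I_k.+1 -> int),
     (forall j, D (a j)) /\ x = \sum_(j < k.+1) (a j)%:~R * p%:R ^- j].

Definition partialZ (p : nat) (D : set int) (e f : nat) (gamma beta : K) :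
    set K :=
  [set c | exists b : 'I_e -> 'I_f -> Qp,
     (forall i j, digitsX p D (b i j)) /\
     c = \sum_(i < e) \sum_(j < f) b i j *: (gamma ^+ j * beta ^+ i)].

Definition partialZstar (p : nat) (D : set int) (v : K -> R) (e f : nat)
    (gamma beta : K) : set K :=
  [set c | partialZ p D e f gamma beta c /\ 1 < v c].

End Extension.

Definition standard_digits (p : nat) : set int := [set d | 0 <= d < p%:Z].

Definition symmetric_digits (p : nat) : set int :=
  [set d | - (p.-1./2)%:Z <= d <= (p.-1./2)%:Z].

(* Finite c0 [:: c1; ...; cn] stands for c0, ..., cn; the separate head makes
   finite sequences nonempty. *)
Inductive partial_quotients (K : Type) : Type :=
| Finite of K & seq K
| Infinite of nat -> K.

(* [c0; c1, ..., cn] with cs = [:: c1; ...; cn]. In MathComp 0^-1 = 0, but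
   when 1 < |cj| for all j >= 1 (with |.| non-Archimedean) every denominator
   is nonzero. *)
Fixpoint cfrac (K : fieldType) (c0 : K) (cs : seq K) : K :=
  if cs is c1 :: cs' then c0 + (cfrac c1 cs')^-1 else c0.

Definition convergent (K : fieldType) (c : nat -> K) (n : nat) : K :=
  cfrac (c 0%N) (mkseq (fun i => c i.+1) n).

Definition is_cfrac_expansion (R : realType) (K : fieldType) (v : K -> R)
    (Z Zstar : set K) (alpha : K) (s : partial_quotients K) : Prop :=
  match s with
  | Finite c0 cs =>
      [/\ Z c0, forall c, c \in cs -> Zstar c & alpha = cfrac c0 cs]
  | Infinite c =>
      [/\ Z (c 0%N), forall j, Zstar (c j.+1)
        & (fun n => v (convergent c n - alpha)) @ \oo --> (0 : R)]
  end.

(* Main.v *)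
(** The expansion exists and is unique because [Z] is a system of integer parts:
    every [x] in [K] is within distance [< 1] of exactly one [c] in [Z]. The
    complete quotient [1 / (x - c)] then has absolute value [> 1], as has its
    integer part, so the algorithm runs; since values [> 1] are at least
    [v beta > 1] and [x |-> 1 / x] is a contraction there, convergents converge
    geometrically. Conversely the tail of any expansion has the absolute value
    of its first term, so its head is the integer part.

    For the integer parts, the powers of [gamma] are pairwise incongruent
    modulo the maximal ideal, which by counting forces [gamma ^+ j], [j < f], to
    be a basis of the residue field, while the [v beta ^+ i], [i < e], represent
    the cosets of the value group. Hence [x] can be approximated successively by
    combinations of the [gamma ^+ j * beta ^+ i], the size of such a combination
    is governed by the size of its coefficients, and the question reduces to
    integer parts in [Qp], obtained from digit expansions. *)

Require Import Defs.
From HB Require Import structures.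
From mathcomp Require Import all_boot all_order all_algebra all_field.
From mathcomp Require Import all_classical all_reals all_analysis.
From mathcomp Require Import zify ring lra.
Import Order.TTheory GRing.Theory Num.Theory.
Import numFieldNormedType.Exports.

Local Open Scope classical_set_scope.
Local Open Scope ring_scope.

(** * Ultrametric absolute values *)

(** With [t = 1 + h] and [h > 0], Bernoulli's inequality gives [t ^+ (n * 2) >= (1 + n h) ^+ 2],
    which exceeds [2 n + 1] as soon as [n h ^+ 2 > 2]. *)
Lemma exprn_bounded_by_linear (R : realType) (t : R) :
  0 <= t -> (forall n, t ^+ n <= n.+1%:R) -> t <= 1.
Proof.
move=> t0 H; rewrite leNgt; apply/negP => t1.
pose h := t - 1; have h0 : 0 < h by rewrite subr_gt0.
have bern n : 1 + n%:R * h <= t ^+ n.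
  elim: n => [|n IHn]; first by rewrite mul0r addr0.
  rewrite exprS (le_trans _ (ler_wpM2l t0 IHn))// -natr1.
  rewrite {1}(_ : t = 1 + h); last first.
    by rewrite /h addrC subrK.
  have : 0 <= n%:R * h ^+ 2 by rewrite mulr_ge0// sqr_ge0.
  nra.
have [n] : exists n : nat, 2 / h ^+ 2 < n%:R.
  exists (Num.truncn (2 / h ^+ 2)).+1; exact: truncnS_gt.
rewrite ltr_pdivrMr ?exprn_gt0// => nh.
have n0 : 0 < n%:R :> R.
  by rewrite ltr0n lt0n; apply/eqP => n0; move: nh; rewrite n0 mul0r ltNge ler0n.
have := H (n * 2)%N; rewrite exprM; apply/negP; rewrite -ltNge.
have h1 : 0 <= 1 + n%:R * h by rewrite addr_ge0// mulr_ge0// ltW.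
apply: (@lt_le_trans _ _ ((1 + n%:R * h) ^+ 2)); last first.
  by rewrite lerXn2r// ?nnegrE ?exprn_ge0.
rewrite -natr1 natrM.
have : 0 < n%:R * h by rewrite mulr_gt0.
have : n%:R * 2 < n%:R * (n%:R * h ^+ 2) by rewrite ltr_pM2l.
nra.
Qed.

Section AbsoluteValue.
Local Set Implicit Arguments.
Local Unset Strict Implicit.
Variables (R : realType) (F : fieldType) (v : F -> R).
Hypothesis v_abs : is_absolute_value v.

Lemma absv_ge0 x : 0 <= v x. Proof. by case: v_abs. Qed.

Lemma absv_eq0 x : (v x == 0) = (x == 0).
Proof. by case: v_abs => _ v0 _ _; apply/eqP/eqP => /v0. Qed.

Lemma absv0 : v 0 = 0. Proof. by apply/eqP; rewrite absv_eq0. Qed.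

Lemma absv_gt0 x : (0 < v x) = (x != 0).
Proof. by rewrite lt_def absv_ge0 absv_eq0 andbT. Qed.

Lemma absvM x y : v (x * y) = v x * v y. Proof. by case: v_abs. Qed.

Lemma absv1 : v 1 = 1.
Proof.
have v1 : v 1 != 0 by rewrite absv_eq0 oner_eq0.
by apply: (mulfI v1); rewrite -absvM !mulr1.
Qed.

Lemma absvX x n : v (x ^+ n) = v x ^+ n.
Proof. by elim: n => [|n IHn]; rewrite ?absv1// !exprS absvM IHn. Qed.

Lemma absvN x : v (- x) = v x.
Proof.
apply/eqP; rewrite -(@eqrXn2 _ 2) ?absv_ge0//; apply/eqP.
by rewrite -!absvX sqrrN.
Qed.

Lemma absvBC x y : v (x - y) = v (y - x). Proof. by rewrite -absvN opprB. Qed.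

Lemma absvV x : v x^-1 = (v x)^-1.
Proof.
have [->|x0] := eqVneq x 0; first by rewrite invr0 absv0 invr0.
have vx0 : v x != 0 by rewrite absv_eq0.
by apply: (mulfI vx0); rewrite -absvM !divff// absv1.
Qed.

Lemma absv_sum_le (I : Type) (r : seq I) (P : pred I) (G : I -> F) :
  v (\sum_(i <- r | P i) G i) <= \sum_(i <- r | P i) v (G i).
Proof.
apply: (big_ind2 (fun x y => v x <= y)) => [|x x' y y' xx' yy'|//].
  by rewrite absv0.
have [_ _ _ vD] := v_abs.
by rewrite (le_trans (vD _ _))// lerD.
Qed.

(* Expand [(x + y) ^+ n] and let [n] tend to infinity. *)
Lemma absv_ultrametric : (forall n, v n%:R <= 1) ->
  forall x y, v (x + y) <= Num.max (v x) (v y).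
Proof.
move=> vn x y; set M := Num.max _ _.
have M0 : 0 <= M by rewrite le_max absv_ge0.
have [M_eq0|M_neq0] := eqVneq M 0.
  have vx : v x <= 0 by rewrite -M_eq0 le_max lexx.
  have vy : v y <= 0 by rewrite -M_eq0 le_max lexx orbT.
  have [_ _ _ vD] := v_abs.
  by rewrite (le_trans (vD _ _))// (le_trans (lerD vx vy))// addr0.
have M_gt0 : 0 < M by rewrite lt_def M_neq0.
suff : v (x + y) / M <= 1 by rewrite ler_pdivrMr// mul1r.
apply: exprn_bounded_by_linear => [|n]; first by rewrite divr_ge0// absv_ge0.
rewrite exprMn exprVn ler_pdivrMr ?exprn_gt0// -absvX exprDn.
rewrite (le_trans (absv_sum_le _ _ _))//.
rewrite (_ : n.+1%:R * _ = \sum_(i < n.+1) M ^+ n); last first.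
  by rewrite sumr_const card_ord mulr_natl.
apply: ler_sum => i _; rewrite -mulr_natl absvM.
rewrite -[leRHS]mul1r ler_pM ?absv_ge0// absvM !absvX.
rewrite -[in leRHS](@subnK i n) ?(ltnSE (ltn_ord i))// exprD.
by rewrite ler_pM ?exprn_ge0 ?absv_ge0// lerXn2r ?nnegrE ?absv_ge0//
  le_max lexx ?orbT.
Qed.

Hypothesis v_ultra : forall x y, v (x + y) <= Num.max (v x) (v y).

Lemma absvD_lt x y c : v x < c -> v y < c -> v (x + y) < c.
Proof. by move=> xc yc; rewrite (le_lt_trans (v_ultra _ _))// gt_max xc. Qed.

Lemma absvB_lt x y c : v x < c -> v y < c -> v (x - y) < c.
Proof. by move=> xc yc; rewrite absvD_lt// absvN. Qed.

Lemma absvB_lt_trans y x z c : v (x - y) < c -> v (y - z) < c -> v (x - z) < c.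
Proof. by move=> xy yz; rewrite -(subrK y x) -addrA absvD_lt. Qed.

Lemma absvD_le x y c : v x <= c -> v y <= c -> v (x + y) <= c.
Proof. by move=> xc yc; rewrite (le_trans (v_ultra _ _))// ge_max xc. Qed.

Lemma absvB_le x y c : v x <= c -> v y <= c -> v (x - y) <= c.
Proof. by move=> xc yc; rewrite absvD_le// absvN. Qed.

Lemma absv_sum_lt (I : Type) (r : seq I) (P : pred I) (G : I -> F) c :
  0 < c -> (forall i, P i -> v (G i) < c) -> v (\sum_(i <- r | P i) G i) < c.
Proof.
by move=> c0 Gc; apply: (big_ind (fun x => v x < c)) => //;
  [rewrite absv0 | move=> x y; apply: absvD_lt].
Qed.

Lemma absv_sum_le_max (I : Type) (r : seq I) (P : pred I) (G : I -> F) c :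
  0 <= c -> (forall i, P i -> v (G i) <= c) -> v (\sum_(i <- r | P i) G i) <= c.
Proof.
by move=> c0 Gc; apply: (big_ind (fun x => v x <= c)) => //;
  [rewrite absv0 | move=> x y; apply: absvD_le].
Qed.

(** The isosceles principle: if [v y] were below [v x], then [x = (x - y) + y] would be a sum of two
    terms smaller than itself. *)
Lemma absv_dominant x y : v (x - y) < v x -> v y = v x.
Proof.
move=> h; apply/eqP; rewrite eq_le; apply/andP; split.
  by rewrite -(subKr x y) absvB_le// ltW.
rewrite leNgt; apply/negP => yx.
by have := absvD_lt h yx; rewrite subrK ltxx.
Qed.

Lemma absv_dominant1 x y : v (x - y) < 1 -> 1 <= v x -> v y = v x.
Proof. by move=> xy x1; apply: absv_dominant; apply: lt_le_trans x1. Qed.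

Lemma absv_sub_inv x y : x != 0 -> y != 0 ->
  v (x^-1 - y^-1) = v (x - y) / (v x * v y).
Proof.
move=> x0 y0; rewrite (_ : x^-1 - y^-1 = (y - x) / (x * y)); last first.
  by field; rewrite x0 y0.
by rewrite absvM absvV absvM absvBC.
Qed.

(** A nonzero term of largest value strictly dominates all the others, so it alone determines the
    value of the sum. *)
Lemma absv_le_sum_distinct (I : finType) (G : I -> F) :
  (forall i j, G i != 0 -> G j != 0 -> v (G i) = v (G j) -> i = j) ->
  forall i, v (G i) <= v (\sum_j G j).
Proof.
move=> inj i.
have [k _ kmax] := @arg_maxP _ R I i xpredT (fun j => v (G j)) isT.
apply: (le_trans (kmax i isT)).
have [->|Gk0] := eqVneq (G k) 0; first by rewrite absv0 absv_ge0.
rewrite -(@absv_dominant (G k) (\sum_j G j))//.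
rewrite absvBC (bigD1 k)//= addrC addrK absv_sum_lt ?absv_gt0// => j jk.
rewrite lt_neqAle; apply/andP; split; last exact: kmax.
apply/eqP => jkE.
have Gj0 : G j != 0 by rewrite -absv_eq0 jkE absv_eq0.
by move: jk; rewrite (inj _ _ Gj0 Gk0 jkE) eqxx.
Qed.

End AbsoluteValue.

(** * Continued fractions from integer parts *)

Lemma cvg0P (R : realType) (u : nat -> R) : (forall n, 0 <= u n) ->
  u @ \oo --> (0 : R) <->
  forall eps, 0 < eps -> exists N : nat, forall n, (N <= n)%N -> u n < eps.
Proof.
move=> u0; split=> [/cvgr0Pnorm_lt cu eps /cu [N _ HN]|cu].
  by exists N => n Nn; have := HN n Nn; rewrite /= ger0_norm.
apply/cvgr0Pnorm_lt => eps /cu [N HN].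
by exists N => // n Nn /=; rewrite ger0_norm// HN.
Qed.

Section ContinuedFractions.
Local Set Implicit Arguments.
Local Unset Strict Implicit.
Variables (R : realType) (K : fieldType) (v : K -> R) (Z : set K).
Hypothesis v_abs : is_absolute_value v.
Hypothesis v_ultra : forall x y, v (x + y) <= Num.max (v x) (v y).
Hypothesis Z_floor : forall x, exists c, Z c /\ v (x - c) < 1.
Hypothesis Z_separated : forall c d, Z c -> Z d -> v (c - d) < 1 -> c = d.
Variable rho : R.
Hypothesis rho_gt1 : 1 < rho.
Hypothesis rho_le : forall x, 1 < v x -> rho <= v x.

Let Zstar : set K := [set c | Z c /\ 1 < v c].
Local Notation expansion := (is_cfrac_expansion v Z Zstar).

(** What is added to [c] is the inverse of an element of value above 1, so [c] dominates. *)
Lemma absv_cfrac c cs : 1 < v c -> (forall d, d \in cs -> 1 < v d) ->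
  v (cfrac c cs) = v c.
Proof.
elim: cs c => [//|d cs IHcs] c c1 cs1 /=.
have d1 : 1 < v d by apply: cs1; rewrite mem_head.
apply: (absv_dominant v_abs v_ultra).
rewrite opprD addNKr absvN// absvV// IHcs//; last first.
  by move=> x xcs; apply: cs1; rewrite inE xcs orbT.
by rewrite (lt_trans _ c1)// invf_lt1// (lt_trans _ d1).
Qed.

Lemma convergentS (c : nat -> K) n :
  convergent c n.+1 = c 0%N + (convergent (fun i => c i.+1) n)^-1.
Proof.
by rewrite /convergent /mkseq /= (iotaDl 1 0 n) -map_comp.
Qed.

Lemma absv_convergent (c : nat -> K) n : (forall j, 1 < v (c j)) ->
  v (convergent c n) = v (c 0%N).
Proof. by move=> c1; apply: absv_cfrac => // d /mapP[i _ ->]. Qed.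

Definition converges_to (c : nat -> K) (x : K) :=
  (fun n => v (convergent c n - x)) @ \oo --> (0 : R).

Lemma converges_toP c x : converges_to c x <->
  forall eps, 0 < eps -> exists N : nat,
    forall n, (N <= n)%N -> v (convergent c n - x) < eps.
Proof. by apply: cvg0P => n; apply: absv_ge0. Qed.

(** From index 1 on, all convergents are at the same distance [(v (c 1%N))^-1] from [c 0%N]; one
    that is closer than this to [x] passes the distance on to [x]. *)
Lemma converges_to_abs c x : (forall j, 1 < v (c j.+1)) -> converges_to c x ->
  v (x - c 0%N) = (v (c 1%N))^-1.
Proof.
move=> c1 /converges_toP cx.
have w0 : 0 < (v (c 1%N))^-1 by rewrite invr_gt0 (lt_trans _ (c1 0%N)).
have [N /(_ N.+1 (leqnSn N))] := cx _ w0.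
have wE : v (convergent (fun i => c i.+1) N)^-1 = (v (c 1%N))^-1.
  by rewrite absvV// absv_convergent.
rewrite convergentS addrAC -opprB addrC -wE; exact: (absv_dominant v_abs v_ultra).
Qed.

Lemma converges_to_tail c x : (forall j, 1 < v (c j.+1)) -> converges_to c x ->
  converges_to (fun i => c i.+1) (x - c 0%N)^-1.
Proof.
move=> c1 cx; have xE := converges_to_abs c1 cx.
have w0 : 0 < (v (c 1%N))^-1 by rewrite invr_gt0 (lt_trans _ (c1 0%N)).
have y0 : x - c 0%N != 0 by rewrite -(absv_gt0 v_abs) xE.
apply/converges_toP => eps eps0; move/converges_toP: cx.
(* Between elements of value [(v (c 1%N))^-1], inversion multiplies distances by
   [v (c 1%N) ^+ 2]. *)
case/(_ (eps * ((v (c 1%N))^-1 * (v (c 1%N))^-1)))=> [|N HN].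
  by rewrite !mulr_gt0.
exists N => n Nn; have {HN} := HN n.+1 (leqW Nn); rewrite convergentS.
set z := convergent _ _; have zE : v z = v (c 1%N) by apply: absv_convergent.
have z0 : z != 0 by rewrite -(absv_gt0 v_abs) zE (lt_trans _ (c1 0%N)).
have zi0 : z^-1 != 0 by rewrite invr_eq0.
have := absv_sub_inv v_abs zi0 y0; rewrite invrK (absvV v_abs z) zE xE => ->.
by rewrite ltr_pdivrMr ?mulr_gt0// opprB addrCA addrA.
Qed.

(** * Uniqueness of expansions *)

Lemma expansion_finite0 c x : expansion x (Defs.Finite c [::]) -> Z c /\ x = c.
Proof. by case. Qed.

Lemma expansion_finiteS c d cs x : expansion x (Defs.Finite c (d :: cs)) ->
  [/\ Z c, 0 < v (x - c) < 1 & expansion (x - c)^-1 (Defs.Finite d cs)].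
Proof.
case=> Zc Zcs ->; have [Zd d1] : Zstar d by apply: Zcs; rewrite mem_head.
have Zcs' y : y \in cs -> Zstar y by move=> ycs; apply: Zcs; rewrite inE ycs orbT.
split=> //=; rewrite addrC addKr ?invrK//.
have d0 : 0 < v d by apply: lt_trans d1.
rewrite absvV// absv_cfrac//; first by rewrite invr_gt0 invf_lt1// d0.
by move=> y /Zcs'[].
Qed.

Lemma expansion_infiniteS c x : expansion x (Defs.Infinite c) ->
  [/\ Z (c 0%N), 0 < v (x - c 0%N) < 1 &
      expansion (x - c 0%N)^-1 (Defs.Infinite (fun i => c i.+1))].
Proof.
case=> Zc0 Zc cx; have c1 j : 1 < v (c j.+1) by case: (Zc j).
have d0 : 0 < v (c 1%N) by apply: lt_trans (c1 0%N).
split=> //; first by rewrite converges_to_abs// invr_gt0 invf_lt1// d0 c1.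
by split; [case: (Zc 0%N) | move=> j; exact: Zc | exact: converges_to_tail].
Qed.

Lemma floor_unique x c d : Z c -> Z d -> v (x - c) < 1 -> v (x - d) < 1 -> c = d.
Proof.
move=> Zc Zd xc xd; apply: Z_separated => //.
by apply: (absvB_lt_trans v_ultra (y := x)) => //; rewrite absvBC.
Qed.

(** Rules out that one expansion stops where another goes on: an element of [Z] is its own integer
    part. *)
Lemma floor_exact x c : Z x -> Z c -> 0 < v (x - c) < 1 -> False.
Proof.
move=> Zx Zc /andP[xc0 xc1]; move: xc0.
by rewrite (Z_separated Zx Zc xc1) subrr absv0// ltxx.
Qed.

(** Both heads are the integer part of [x], and both tails then expand the same complete quotient;
    hence an induction along [cs], against [s] of either kind. *)
Lemma expansion_finite_unique x c cs s :
  expansion x (Defs.Finite c cs) -> expansion x s -> Defs.Finite c cs = s.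
Proof.
elim: cs x c s => [|c1 cs IHcs] x c s.
  move=> /expansion_finite0[Zc ->]; case: s => [d [|d1 ds]|d].
  - by case/expansion_finite0=> _ ->.
  - by case/expansion_finiteS=> Zd /(floor_exact Zc Zd).
  - by case/expansion_infiniteS=> Zd /(floor_exact Zc Zd).
move=> /expansion_finiteS[Zc xc xcs]; have [_ xc1] := andP xc.
case: s => [d [|d1 ds]|d].
- by case/expansion_finite0=> Zd xd; move: xc; rewrite xd => /(floor_exact Zd Zc).
- case/expansion_finiteS=> Zd /andP[_ xd1] xds.
  have cd := floor_unique Zc Zd xc1 xd1; subst d.
  by case: (IHcs _ _ _ xcs xds) => -> ->.
- case/expansion_infiniteS=> Zd /andP[_ xd1].
  by rewrite -(floor_unique Zc Zd xc1 xd1) => /(IHcs _ _ _ xcs).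
Qed.

Lemma expansion_infinite_unique x c d :
  expansion x (Defs.Infinite c) -> expansion x (Defs.Infinite d) -> c = d.
Proof.
move=> xc xd; apply/funext => n; elim: n x c d xc xd => [|n IHn] x c d.
  move=> /expansion_infiniteS[Zc /andP[_ xc] _].
  by move=> /expansion_infiniteS[Zd /andP[_ xd] _]; apply: floor_unique xd.
move=> /expansion_infiniteS[Zc /andP[_ xc] xcs].
move=> /expansion_infiniteS[Zd /andP[_ xd]].
rewrite -(floor_unique Zc Zd xc xd); exact: (IHn _ _ _ xcs).
Qed.

Lemma expansion_unique x s t : expansion x s -> expansion x t -> s = t.
Proof.
case: s => [c cs|c] xs; first exact: expansion_finite_unique.
case: t => [d ds|d] xt; first exact/esym/(expansion_finite_unique xt).
by rewrite (expansion_infinite_unique xs xt).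
Qed.

(** * Existence of expansions *)

Lemma expansion_exists x : exists s, expansion x s.
Proof.
have [fl flP] := choice Z_floor.
pose T y := (y - fl y)^-1.
have T_gt1 y : y != fl y -> 1 < v (T y).
  by move=> yfl; have [_ ?] := flP y; rewrite absvV// invf_gt1// absv_gt0 ?subr_eq0.
have fl_abs y : 1 < v y -> v (fl y) = v y.
  move=> y1; apply: (absv_dominant v_abs v_ultra).
  by have [_ /lt_trans] := flP y; apply.
have fin n y : iter n T y = fl (iter n T y) ->
    exists c cs, expansion y (Defs.Finite c cs).
  elim: n y => [|n IHn] y /= yn.
    by exists y, [::]; split; rewrite // yn; case: (flP y).
  (* An earlier stop must be caught here: in that case [T y = 0^-1 = 0], and [T_gt1] does not
     apply. *)
  have [yfl|yfl] := eqVneq y (fl y).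
    by exists y, [::]; split; rewrite // yfl; case: (flP y).
  have [|c [cs Hs]] := IHn (T y); first by rewrite -iterSr.
  (* Being the integer part of [T y], the head [c] has the same value, above 1, and so qualifies as
     a later partial quotient. *)
  have [Zc yc] : Z c /\ v (T y - c) < 1.
    case: cs Hs => [/expansion_finite0[Zc ->]|d cs].
      by rewrite subrr absv0.
    by case/expansion_finiteS=> ? /andP[].
  have c1 : 1 < v c.
    by rewrite (absv_dominant1 v_abs v_ultra yc) ?ltW ?T_gt1.
  case: Hs => _ Zcs TyE; exists (fl y), (c :: cs); split.
  - by case: (flP y).
  - by move=> d; rewrite inE => /predU1P[->|/Zcs].
  - by rewrite /= -TyE invrK addrC subrK.
have [[n /fin[c [cs xs]]]|nfin] := pselect (exists n, iter n T x = fl (iter n T x)).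
  by exists (Defs.Finite c cs).
(* From here on, facts are stated on the whole orbit of [x], which is stable under [T], so that
   inductions can pass from [y] to [T y]. *)
have {}nfin y : (exists n, y = iter n T x) -> y != fl y.
  by move=> [n ->]; apply/eqP => nE; apply: nfin; exists n.
pose c y n := fl (iter n T y).
have cS y n : c y n.+1 = c (T y) n by rewrite /c iterSr.
have c1 y j : (exists n, y = iter n T x) -> 1 < v (c y j.+1).
  move=> [n ->]; rewrite /c -iterD addSn fl_abs /= T_gt1// nfin//;
  by exists (j + n)%N.
have xT y : (exists n, y = iter n T x) -> exists n, T y = iter n T x.
  by case=> n ->; exists n.+1.
exists (Defs.Infinite (c x)); split; first by case: (flP x).
  move=> j; split; first by case: (flP (iter j.+1 T x)).
  by apply: c1; exists 0%N.
(* The convergents of [T y] have the value of [T y], which is at least [rho]; inversion therefore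
   shrinks their distance to [T y] at least by the factor [rho ^+ 2], of which one [rho] is kept. *)
have bound n y : (exists n, y = iter n T x) ->
    v (convergent (c y) n - y) <= rho^-1 ^+ n.
  elim: n y => [|n IHn] y yx; first by case: (flP y) => _ /ltW; rewrite absvBC.
  have Ty1 := T_gt1 _ (nfin _ yx).
  have Ty0 : T y != 0 by rewrite -(absv_gt0 v_abs) (lt_trans _ Ty1).
  rewrite convergentS (_ : (fun i => _) = c (T y)); last exact/funext/cS.
  have zc : v (convergent (c (T y)) n) = v (T y).
    rewrite -(fl_abs _ Ty1) absv_convergent//.
    by case=> [|j]; [rewrite /c /= fl_abs | exact/c1/xT].
  set z := convergent _ _ in zc *.
  have z0 : z != 0 by rewrite -(absv_gt0 v_abs) zc (lt_trans _ Ty1).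
  rewrite (_ : _ - y = z^-1 - (T y)^-1); last first.
    by rewrite /T /c invrK opprB /= addrA [z^-1 + _]addrC.
  rewrite (absv_sub_inv v_abs)// exprSr ler_pM ?(absv_ge0 v_abs)//.
  - by rewrite invr_ge0 mulr_ge0 ?(absv_ge0 v_abs).
  - exact/IHn/xT.
  - rewrite zc lef_pV2 ?posrE ?mulr_gt0 ?(lt_trans _ Ty1) ?(lt_trans _ rho_gt1)//.
    by rewrite (le_trans (rho_le Ty1))// ler_peMr ?absv_ge0// ltW.
apply: (@squeeze_cvgr _ _ _ _ (fun=> 0) (fun n => rho^-1 ^+ n)).
- by apply: nearW => n; rewrite absv_ge0//= bound//; exists 0%N.
- exact: cvg_cst.
- have rho0 : 0 < rho by apply: lt_trans rho_gt1.
  by apply: cvg_expr; rewrite gtr0_norm ?invr_gt0// invf_lt1.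
Qed.

Lemma expansion_exists_unique x : exists! s, expansion x s.
Proof.
have [s xs] := expansion_exists x.
by exists s; split=> // t; exact: expansion_unique.
Qed.

End ContinuedFractions.

(** * Residue systems *)

(** Treats both digit sets at once; [D 0] allows digit strings to be padded with zeros. *)
Definition residue_system (p : nat) (D : set int) : Prop :=
  [/\ D 0, forall n, exists d, D d /\ (p %| n - d)%Z
    & forall a b, D a -> D b -> (p %| a - b)%Z -> a = b].

Lemma dvdz_small (p : nat) (n : int) : (p %| n)%Z -> `|n| < p%:Z -> n = 0.
Proof.
rewrite dvdzE -abszE ltz_nat => pn np; apply/eqP; rewrite -absz_eq0.
by apply: contraLR np; rewrite -lt0n -leqNgt => /dvdn_leq; apply.
Qed.

Lemma standard_residue_system (p : nat) : (0 < p)%N ->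
  residue_system p (standard_digits p).
Proof.
rewrite /standard_digits /mkset => p0; split=> /=; first by lia.
  move=> n; exists (n %% p)%Z; split.
    by rewrite modz_ge0 ?ltz_pmod//; lia.
  by apply/dvdzP; exists (n %/ p)%Z; rewrite {1}(divz_eq n p) addrK.
move=> a b ha hb ab; apply/eqP; rewrite -subr_eq0; apply/eqP.
by apply: dvdz_small ab _; lia.
Qed.

Lemma symmetric_residue_system (p : nat) : odd p ->
  residue_system p (symmetric_digits p).
Proof.
rewrite /symmetric_digits /mkset => p_odd.
have pE : p = (p.-1./2.*2).+1 by lia.
move: (p.-1./2) pE => h pE; split=> /=; first by lia.
  (* As [p = 2 h + 1], shifting by [h] moves the remainders from [[0, 2 h]] to [[- h, h]]. *)
  move=> n; exists (((n + h%:Z) %% p)%Z - h%:Z).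
  have p0 : p%:Z != 0 by lia.
  have := modz_ge0 (n + h%:Z) p0; have := @ltz_pmod (n + h%:Z) p.
  split; first by lia.
  apply/dvdzP; exists ((n + h%:Z) %/ p)%Z.
  by rewrite opprB addrA {1}(divz_eq (n + h%:Z) p) addrK.
move=> a b ha hb ab; apply/eqP; rewrite -subr_eq0; apply/eqP.
by apply: dvdz_small ab _; lia.
Qed.

(** * Integer parts in the p-adic numbers *)

Section PadicField.
Local Set Implicit Arguments.
Local Unset Strict Implicit.
Variables (R : realType) (p : nat) (Qp : fieldType) (vp : Qp -> R).
Hypothesis p_prime : prime p.
Hypothesis Qp_padic : is_padic_field p vp.

Lemma padic_absv : is_absolute_value vp. Proof. by case: Qp_padic. Qed.
Let vp_abs := padic_absv.

Lemma padicR_gt0 : 0 < p%:R :> R. Proof. by rewrite ltr0n prime_gt0. Qed.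
Let p_gt0 := padicR_gt0.

Lemma padicR_gt1 : 1 < p%:R :> R. Proof. by rewrite ltr1n prime_gt1. Qed.
Let p_gt1 := padicR_gt1.

Lemma padic_int (n : int) : n != 0 ->
  vp n%:~R = (p%:R ^+ logn p `|n|%N)^-1.
Proof.
case: Qp_padic => _ vpq _ _ n0; rewrite -ratr_int vpq /padic_abs_rat.
by rewrite intr_eq0 (negPf n0) denq_int numq_int logn1 expr0 mul1r.
Qed.

Lemma padic_int_le1 (n : int) : vp n%:~R <= 1.
Proof.
have [->|n0] := eqVneq n 0; first by rewrite absv0.
by rewrite padic_int// invf_le1 ?exprn_gt0// exprn_ege1// ltW.
Qed.

Lemma padic_nat_le1 (n : nat) : vp n%:R <= 1.
Proof. exact: (padic_int_le1 n). Qed.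

Lemma padic_int_lt1 (n : int) : (vp n%:~R < 1) = (p %| n)%Z.
Proof.
have [->|n0] := eqVneq n 0; first by rewrite absv0// ltr01 dvdz0.
rewrite padic_int// invf_lt1 ?exprn_gt0// dvdzE.
have n_gt0 : (0 < `|n|)%N by rewrite absz_gt0.
have := pfactor_dvdn 1 p_prime n_gt0; rewrite expn1 => ->.
have [->|l0] := posnP (logn p `|n|); first by rewrite expr0 ltxx.
by rewrite exprn_egt1// -lt0n.
Qed.

Lemma padic_p : vp p%:R = p%:R^-1.
Proof.
rewrite (@padic_int p) ?pnatr_eq0 -?lt0n ?prime_gt0//.
by rewrite absz_nat -[X in logn _ X]expn1 pfactorK.
Qed.

Lemma padic_ultra x y : vp (x + y) <= Num.max (vp x) (vp y).
Proof. exact: (absv_ultrametric vp_abs padic_nat_le1). Qed.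
Let vp_ultra := padic_ultra.

Lemma padic_p_neq0 : p%:R != 0 :> Qp.
Proof. by rewrite -(absv_gt0 vp_abs) padic_p invr_gt0. Qed.

Lemma padic_pX (n : nat) : vp (p%:R ^- n) = p%:R ^+ n.
Proof. by rewrite absvV// absvX// padic_p exprVn invrK. Qed.

(** A rational closer to [a] than [vp a] has the same value, and for rationals the formula is
    explicit. *)
Lemma padic_value a : a != 0 -> exists k : int, vp a = p%:R ^ k.
Proof.
rewrite -(absv_gt0 vp_abs) => a0; have [_ vpq dense _] := Qp_padic.
have [q aq] := dense a _ a0.
have vqa := absv_dominant vp_abs vp_ultra aq.
have q0 : q != 0.
  by apply: contraTneq a0 => q0; rewrite -vqa vpq /padic_abs_rat q0 eqxx ltxx.
exists ((logn p `|denq q|)%:Z - (logn p `|numq q|)%:Z).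
by rewrite -vqa vpq /padic_abs_rat (negPf q0) expfzDr ?gt_eqF// -exprnN.
Qed.

Lemma padic_lt1 a : vp a < 1 -> vp a <= p%:R^-1.
Proof.
have [->|a0] := eqVneq a 0; first by rewrite absv0// invr_ge0 ltW.
have [k ->] := padic_value a0; rewrite -(expr0z p%:R) ltr_eXz2l// => k0.
by rewrite -exprN1 ler_eXz2l//; lia.
Qed.

(** A nearby rational [q] has a denominator prime to [p], which Bezout inverts modulo [p]; [n] is
    the numerator times that inverse. *)
Lemma padic_residue a : vp a <= 1 -> exists n : int, vp (a - n%:~R) < 1.
Proof.
move=> a1; have [_ vpq dense _] := Qp_padic.
have [q aq] := dense a _ ltr01.
have q1 : vp (ratr q) <= 1.
  rewrite -(subKr a (ratr q)); apply: (absvB_le vp_abs vp_ultra) => //.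
  exact: ltW.
(* If [p] divided the denominator, [vp (ratr q) <= 1] would make it divide the numerator too,
   against lowest terms. *)
have dv : vp (denq q)%:~R = 1.
  apply/eqP; rewrite eq_le padic_int_le1 leNgt; apply/negP => d1.
  have : vp (numq q)%:~R < 1.
    move: q1; rewrite /ratr absvM// absvV// ler_pdivrMr; last first.
      rewrite (absv_gt0 vp_abs) -(absv_eq0 vp_abs) (@padic_int (denq q)).
        by rewrite invr_eq0 expf_neq0// gt_eqF.
      by rewrite denq_eq0.
    by rewrite mul1r => /le_lt_trans; apply.
  move: d1; rewrite !padic_int_lt1 !dvdzE !absz_nat => pd pn.
  have := coprime_num_den q; rewrite /coprime => /eqP gE.
  have : (p %| gcdn `|numq q| `|denq q|)%N by rewrite dvdn_gcd pd pn.
  by rewrite gE dvdn1 => /eqP p1; move: p_prime; rewrite p1.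
have : gcdz (denq q) p = 1.
  have : ~~ (p %| denq q)%Z by rewrite -padic_int_lt1 dv ltxx.
  by rewrite dvdzE -prime_coprime// coprime_sym => /eqP; rewrite /gcdz => ->.
have [u [w uw]] := Bezoutz (denq q) p; rewrite -uw => uw1.
exists (u * numq q); apply: (absvB_lt_trans vp_ultra aq).
have d0 : (denq q)%:~R != 0 :> Qp by rewrite -(absv_eq0 vp_abs) dv oner_eq0.
rewrite (_ : _ - _ = (numq q * w * p%:Z)%:~R / (denq q)%:~R).
  by rewrite absvM// absvV// dv invr1 mulr1 padic_int_lt1 dvdz_mull.
apply: (mulIf d0); rewrite mulrBl /ratr !divfK// -!rmorphM -rmorphB; congr _%:~R.
by rewrite -[X in X - _]mulr1 -uw1; ring.
Qed.

(** * Digit expansions with digits in [D] *)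

Variable D : set int.
Hypothesis D_residue : residue_system p D.

Lemma padic_digit a : vp a <= 1 -> exists d, D d /\ vp (a - d%:~R) < 1.
Proof.
move=> /padic_residue[n an]; case: D_residue => _ /(_ n)[d [Dd nd]] _.
exists d; split=> //; apply: (absvB_lt_trans vp_ultra an).
by rewrite -rmorphB /= padic_int_lt1.
Qed.

Lemma digit_inj (a b : int) : D a -> D b -> vp (a%:~R - b%:~R) < 1 -> a = b.
Proof.
by move=> Da Db; rewrite -rmorphB /= padic_int_lt1; case: D_residue => _ _; apply.
Qed.

(** Digit strings as eventually zero functions on [nat], so that two of them can be brought to a
    common length. *)
Lemma digitsXP (x : Qp) : digitsX p D x <-> exists (k : nat) (a : nat -> int),
  [/\ forall j, D (a j), forall j, (k <= j)%N -> a j = 0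
    & x = \sum_(j < k) (a j)%:~R * p%:R ^- j].
Proof.
have D0 : D 0 by case: D_residue.
split=> [[k [a [Da ->]]]|[k [a [Da ak ->]]]].
  exists k.+1, (fun j => if insub j is Some i then a i else 0); split.
  - by move=> j; case: insub.
  - by move=> j kj; rewrite insubF// ltnNge kj.
  - by apply: eq_bigr => j _; rewrite valK.
exists k, a; split=> //.
by rewrite big_ord_recr /= ak// mul0r addr0.
Qed.

Lemma digit_sum_widen (a : nat -> int) k n : (k <= n)%N ->
  (forall j, (k <= j)%N -> a j = 0) ->
  \sum_(j < k) (a j)%:~R * p%:R ^- j = \sum_(j < n) (a j)%:~R * p%:R ^- j :> Qp.
Proof.
move=> kn ak; rewrite -(subnKC kn) big_split_ord /= [X in _ + X]big1 ?addr0//.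
by move=> i _; rewrite ak ?leq_addr// mul0r.
Qed.

(* The top digits must agree, since a nonzero difference there would dominate
   the sum. *)
Lemma digit_sum_inj (a b : nat -> int) n :
  (forall j, D (a j)) -> (forall j, D (b j)) ->
  vp (\sum_(j < n) (a j)%:~R * p%:R ^- j
      - \sum_(j < n) (b j)%:~R * p%:R ^- j) < 1 ->
  forall j, (j < n)%N -> a j = b j.
Proof.
move=> Da Db; rewrite -sumrB; elim: n => [//|n IHn].
rewrite big_ord_recr /= -mulrBl => h.
have abn : a n = b n.
  apply: digit_inj => //; rewrite ltNge; apply/negP => ab1.
  move: h; apply/negP; rewrite -leNgt.
  have top : p%:R ^+ n <= vp (((a n)%:~R - (b n)%:~R) * p%:R ^- n).
    by rewrite absvM// padic_pX ler_peMl// exprn_ge0// ltW.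
  rewrite addrC (@absv_dominant _ _ _ vp_abs vp_ultra
    (((a n)%:~R - (b n)%:~R) * p%:R ^- n)).
    by rewrite (le_trans _ top)// exprn_ege1// ltW.
  rewrite (lt_le_trans _ top)// opprD addNKr absvN//.
  apply: (absv_sum_lt vp_abs vp_ultra); first by rewrite exprn_gt0.
  move=> j _; rewrite -mulrBl absvM// padic_pX.
  apply: (@le_lt_trans _ _ (p%:R ^+ j)); last by rewrite ltr_eXn2l.
  by rewrite ler_piMl ?exprn_ge0 ?(ltW p_gt0)// -rmorphB padic_int_le1.
move: h; rewrite abn subrr mul0r addr0 => /IHn ab j.
by rewrite ltnS leq_eqVlt => /predU1P[->|/ab].
Qed.

Lemma digitsX_separated (x y : Qp) : digitsX p D x -> digitsX p D y ->
  vp (x - y) < 1 -> x = y.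
Proof.
move=> /digitsXP[k [a [Da ak ->]]] /digitsXP[l [b [Db bl ->]]].
rewrite (digit_sum_widen (leq_maxl k l) ak) (digit_sum_widen (leq_maxr k l) bl).
move=> /(digit_sum_inj Da Db) ab.
by apply: eq_bigr => j _; rewrite ab.
Qed.

(** Greedy from the top: the leading digit is the residue of [x * p%:R ^+ k.+1], and subtracting its
    term lowers the bound on the value by a factor [p]. *)
Lemma digit_sum_approx k x : vp x <= p%:R ^+ k -> exists a : nat -> int,
  (forall j, D (a j)) /\ vp (x - \sum_(j < k.+1) (a j)%:~R * p%:R ^- j) < 1.
Proof.
elim: k x => [|k IHk] x xk.
  have [d [Dd xd]] := padic_digit xk; exists (fun=> d); split=> //.
  by rewrite big_ord1 expr0 invr1 mulr1.
have pk0 : p%:R ^+ k.+1 != 0 :> Qp by rewrite expf_neq0// padic_p_neq0.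
have [|d [Dd xd]] := @padic_digit (x * p%:R ^+ k.+1).
  rewrite absvM// absvX// padic_p exprVn ler_pdivrMr ?exprn_gt0//.
  by rewrite mul1r.
have [|a [Da xa]] := IHk (x - d%:~R * p%:R ^- k.+1).
  have -> : x - d%:~R * p%:R ^- k.+1 = (x * p%:R ^+ k.+1 - d%:~R) * p%:R ^- k.+1.
    by rewrite mulrBl mulfK.
  rewrite absvM// padic_pX; have := padic_lt1 xd.
  move: (vp _) => y yp; rewrite exprS mulrA ler_piMl ?exprn_ge0 ?(ltW p_gt0)//.
  by rewrite -ler_pdivlMr// mul1r.
exists (fun j => if j == k.+1 then d else a j); split; first by move=> j; case: ifP.
rewrite big_ord_recr /= eqxx
  [X in _ - (X + _)](eq_bigr (fun j : 'I_k.+1 => (a j)%:~R * p%:R ^- j)).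
  by rewrite opprD addrA addrAC.
by move=> j _; rewrite ltn_eqF.
Qed.

Lemma digitsX_approx x : exists y, digitsX p D y /\ vp (x - y) < 1.
Proof.
have [k xk] : exists k : nat, vp x <= p%:R ^+ k.
  have [->|x0] := eqVneq x 0; first by exists 0%N; rewrite absv0// expr0.
  have [k ->] := padic_value x0; exists `|k|%N.
  by rewrite exprnP ler_eXz2l// abszE ler_norm.
have [a [Da xa]] := digit_sum_approx xk.
by exists (\sum_(j < k.+1) (a j)%:~R * p%:R ^- j); split=> //; exists k, a.
Qed.

End PadicField.

(** * The residue field *)

Section Extension.
Local Set Implicit Arguments.
Local Unset Strict Implicit.
Variables (R : realType) (p : nat) (Qp : fieldType) (vp : Qp -> R).
Hypothesis p_prime : prime p.
Hypothesis Qp_padic : is_padic_field p vp.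
Variables (K : fieldExtType Qp) (v : K -> R).
Hypothesis v_ext : extends_absolute_value vp v.

Let vp_abs := padic_absv Qp_padic.
Let vp_ultra := padic_ultra p_prime Qp_padic.
Let p_gt0 := padicR_gt0 R p_prime.
Let p_gt1 := padicR_gt1 R p_prime.

Lemma ext_absv : is_absolute_value v. Proof. by case: v_ext. Qed.
Let v_abs := ext_absv.

Lemma ext_absvZ a x : v (a *: x) = vp a * v x.
Proof. by case: v_ext => _ va; rewrite -mulr_algl absvM// va. Qed.

Lemma ext_nat (n : nat) : v n%:R = vp n%:R.
Proof. by case: v_ext => _ va; rewrite -va scaler_nat. Qed.

Lemma ext_ultra x y : v (x + y) <= Num.max (v x) (v y).
Proof.
apply: (absv_ultrametric v_abs) => n.
by rewrite ext_nat (padic_nat_le1 p_prime Qp_padic).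
Qed.
Let v_ultra := ext_ultra.

(** If [z] were congruent to 1, the vanishing sum of the [z ^+ i], [i < N], would be congruent to
    the unit [N]. *)
Lemma unity_root_sub1 (z : K) N : z ^+ N = 1 -> z != 1 -> vp N%:R = 1 ->
  1 <= v (z - 1).
Proof.
move=> zN z1 vN; rewrite leNgt; apply/negP => h.
have N0 : (0 < N)%N.
  by case: N zN vN => // _ /eqP; rewrite absv0// eq_sym oner_eq0.
have vz : v z = 1.
  by apply/eqP; rewrite -(pexpr_eq1 N0) ?absv_ge0// -absvX// zN absv1.
have sum0 : \sum_(i < N) z ^+ i = 0.
  have /eqP := subrX1 z N; rewrite zN subrr eq_sym mulf_eq0 subr_eq0.
  by rewrite (negPf z1) => /eqP.
have : v (\sum_(i < N) z ^+ i - \sum_(i < N) 1) < 1.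
  rewrite -sumrB; apply: (absv_sum_lt v_abs v_ultra) => // i _.
  rewrite subrX1 absvM// (le_lt_trans _ h)// ler_piMr ?absv_ge0//.
  by apply: (absv_sum_le_max v_abs v_ultra) => // j _; rewrite absvX// vz expr1n.
by rewrite sum0 sub0r absvN// sumr_const card_ord ext_nat vN ltxx.
Qed.

(** * Powers of [gamma] modulo the maximal ideal *)

Variables (f : nat) (gamma : K).
Hypothesis f_gt0 : (0 < f)%N.
Hypothesis gamma_prim : (p ^ f - 1)%N.-primitive_root gamma.

Lemma absv_gamma : v gamma = 1.
Proof.
apply/eqP; rewrite -(pexpr_eq1 (prim_order_gt0 gamma_prim)) ?absv_ge0//.
by rewrite -absvX// prim_expr_order// absv1.
Qed.

Lemma absv_gammaX i : v (gamma ^+ i) = 1.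
Proof. by rewrite absvX// absv_gamma expr1n. Qed.

Lemma padic_order : vp (p ^ f - 1)%:R = 1.
Proof.
apply/eqP; rewrite eq_le (padic_nat_le1 p_prime Qp_padic) leNgt /=.
rewrite (padic_int_lt1 p_prime Qp_padic (p ^ f - 1)%N) dvdzE /=.
have pf : (1 <= p ^ f)%N by rewrite expn_gt0 prime_gt0.
apply/negP => /(dvdn_sub (dvdn_exp f_gt0 (dvdnn p))).
by rewrite subKn// dvdn1 => /eqP p1; move: p_prime; rewrite p1.
Qed.

(** Dividing by the unit [gamma ^+ i] leaves a root of unity other than 1, of order prime to [p]. *)
Lemma gammaX_separated i j : (i < j < p ^ f - 1)%N ->
  1 <= v (gamma ^+ i - gamma ^+ j).
Proof.
case/andP=> ij jN; have := ltnW ij => /subnKC jE.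
rewrite -jE exprD -{1}[gamma ^+ i]mulr1 -mulrBr absvM// absv_gammaX mul1r.
rewrite absvBC//; apply: (unity_root_sub1 _ _ padic_order).
  by rewrite exprAC (prim_expr_order gamma_prim) expr1n.
rewrite -(prim_order_dvd gamma_prim) gtnNdvd ?subn_gt0//.
by rewrite (leq_ltn_trans _ jN)// leq_subr.
Qed.

(** Reduction by a monic relation: multiplying a reduced form by [gamma] shifts its coefficients
    ([sh]), and the overflowing top term is rewritten by the hypothesis. *)
Lemma gammaX_reduce d (m : nat -> Qp) : (forall j, vp (m j) <= 1) ->
  v (gamma ^+ d - \sum_(j < d) m j *: gamma ^+ j) < 1 ->
  forall k, exists a : nat -> Qp, (forall j, vp (a j) <= 1) /\
    v (gamma ^+ k - \sum_(j < d) a j *: gamma ^+ j) < 1.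
Proof.
case: d => [|d] m1 dm; first by move: dm; rewrite big_ord0 subr0 absv_gammaX ltxx.
elim=> [|k [a [a1 ka]]].
  exists (fun j => (j == 0)%:R); split.
    by move=> j; rewrite (padic_nat_le1 p_prime Qp_padic).
  rewrite big_ord_recl big1 /= ?addr0 ?scale1r ?subrr ?absv0//.
  by move=> j _; rewrite scale0r.
pose sh (j : nat) : Qp := if j is i.+1 then a i else 0.
exists (fun j => sh j + a d * m j); split.
  move=> j; apply: (absvD_le vp_ultra).
    by case: j => [|j]; rewrite /sh ?(absv0 vp_abs).
  by rewrite absvM// mulr_ile1 ?absv_ge0.
have -> : gamma ^+ k.+1 - \sum_(j < d.+1)
    (sh j + a d * m j) *: gamma ^+ j =
    gamma * (gamma ^+ k - \sum_(j < d.+1) a j *: gamma ^+ j) +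
    a d *: (gamma ^+ d.+1 - \sum_(j < d.+1) m j *: gamma ^+ j).
  under eq_bigr do rewrite scalerDl -scalerA.
  rewrite big_split /= -scaler_sumr big_ord_recl /= scale0r add0r.
  rewrite [in RHS]big_ord_recr /= mulrBr mulrDr -scalerAr -!exprS scalerBr.
  rewrite mulr_sumr (eq_bigr (fun i : 'I_d => gamma * (a i *: gamma ^+ i))).
    by rewrite !opprD !addrA; congr (_ - _); rewrite subrK.
  by move=> i _; rewrite -scalerAr -exprS.
apply: (absvD_lt v_ultra); first by rewrite absvM// absv_gamma mul1r.
by rewrite ext_absvZ (le_lt_trans _ dm)// ler_piMl ?absv_ge0.
Qed.

(** Makes counting possible: modulo the maximal ideal, integral combinations of [d] elements take at
    most [p ^ d] values. *)
Lemma digit_reduce d (a : 'I_d -> Qp) (w : 'I_d -> K) :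
  (forall j, vp (a j) <= 1) -> (forall j, v (w j) <= 1) ->
  exists n : {ffun 'I_d -> 'I_p},
    v (\sum_(j < d) a j *: w j - \sum_(j < d) (n j)%:R *: w j) < 1.
Proof.
move=> a1 w1.
have /choice[n nP] j : exists i : 'I_p, vp (a j - i%:R) < 1.
  have D_std := standard_residue_system p (prime_gt0 p_prime).
  have [z [/andP[z0 zp] az]] := padic_digit p_prime Qp_padic D_std (a1 j).
  case: z z0 zp az => // z _; rewrite ltz_nat => zp az.
  by exists (Ordinal zp).
exists [ffun j => n j]; rewrite -sumrB; apply: (absv_sum_lt v_abs v_ultra) => // j _.
by rewrite ffunE -scalerBl ext_absvZ (le_lt_trans _ (nP j))// ler_piMr ?absv_ge0.
Qed.

(* If [gamma ^+ d] reduced to lower powers, the [p ^ f] residues [0] and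
   [gamma ^+ k] would all be among [p ^ d] combinations. *)
Lemma gammaX_irreducible d (m : nat -> Qp) : (d < f)%N ->
  (forall j, vp (m j) <= 1) ->
  1 <= v (gamma ^+ d - \sum_(j < d) m j *: gamma ^+ j).
Proof.
move=> df m1; rewrite leNgt; apply/negP => dm.
(* [None] stands for 0, which brings the number of elements to [p ^ f]. *)
pose el (o : option 'I_(p ^ f - 1)) : K := oapp (fun k : 'I__ => gamma ^+ k) 0 o.
have /choice[h hP] o : exists n : {ffun 'I_d -> 'I_p},
    v (el o - \sum_(j < d) (n j)%:R *: gamma ^+ j) < 1.
  have w1 (j : 'I_d) : v (gamma ^+ j) <= 1 by rewrite absv_gammaX.
  have [a [a1 oa]] : exists a : nat -> Qp, (forall j, vp (a j) <= 1) /\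
      v (el o - \sum_(j < d) a j *: gamma ^+ j) < 1.
    case: o => [k|] /=; first exact: gammaX_reduce dm k.
    exists (fun=> 0); rewrite absv0//; split=> //.
    by rewrite big1 ?subrr ?absv0// => j _; rewrite scale0r.
  have [n an] := @digit_reduce d (fun j => a j) _ (fun j => a1 j) w1.
  by exists n; apply: (absvB_lt_trans v_ultra oa).
have el_sep o o' : v (el o - el o') < 1 -> o = o'.
  case: o o' => [k|] [l|] //=; rewrite ?subr0 ?sub0r ?absvN// ?absv_gammaX ?ltxx//.
  have [kl|kl|/ord_inj->//] := ltngtP k l => /lt_geF.
    by rewrite gammaX_separated// kl ltn_ord.
  by rewrite absvBC// gammaX_separated// kl ltn_ord.
have h_inj : injective h.
  move=> o o' hoo'; apply: el_sep; apply: (absvB_lt_trans v_ultra (hP o)).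
  by rewrite hoo' absvBC.
have := leq_card h h_inj.
rewrite card_option card_ord card_ffun !card_ord subn1 prednK ?expn_gt0 ?prime_gt0//.
by rewrite leq_exp2l ?prime_gt1// leqNgt df.
Qed.

Lemma gamma_nat_indep (a : nat -> Qp) n : (n <= f)%N ->
  (forall j, vp (a j) <= 1) -> v (\sum_(j < n) a j *: gamma ^+ j) < 1 ->
  forall j, (j < n)%N -> vp (a j) < 1.
Proof.
move=> nf a1; elim: n nf => [//|n IHn] nf h.
have an : vp (a n) < 1.
  rewrite ltNge; apply/negP => an1; have an : vp (a n) = 1.
    by apply/eqP; rewrite eq_le a1.
  have an0 : a n != 0 by rewrite -(absv_gt0 vp_abs) an.
  have m1 j : vp (- (a j / a n)) <= 1 by rewrite absvN// absvM// absvV// an divr1.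
  have := gammaX_irreducible nf m1; rewrite leNgt => /negP; apply.
  rewrite -[ltLHS]mul1r -an -ext_absvZ scalerBr scaler_sumr -sumrN.
  rewrite (eq_bigr (fun j : 'I_n => a j *: gamma ^+ j)); last first.
    by move=> j _; rewrite scaleNr scalerN opprK scalerA mulrCA divff// mulr1.
  by move: h; rewrite big_ord_recr /= addrC an.
move=> j; rewrite ltnS leq_eqVlt => /predU1P[->//|].
apply: IHn; first exact: ltnW.
rewrite -(addrK (a n *: gamma ^+ n) (\sum_(j < n) _)).
move: h; rewrite big_ord_recr /= => h; apply: (absvB_lt v_abs v_ultra) => //.
by rewrite ext_absvZ absv_gammaX mulr1.
Qed.

Lemma gamma_indep (a : 'I_f -> Qp) : (forall j, vp (a j) <= 1) ->
  v (\sum_(j < f) a j *: gamma ^+ j) < 1 -> forall j, vp (a j) < 1.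
Proof.
move=> a1 h j; pose a' n := oapp a 0 (insub n).
have a'E (i : 'I_f) : a' i = a i by rewrite /a' valK.
rewrite -a'E; apply: (@gamma_nat_indep a' f) => //; last first.
  by under eq_bigr do rewrite a'E.
by move=> n; rewrite /a'; case: insub => //=; rewrite absv0.
Qed.

(** Dividing by a coefficient of largest value makes all coefficients integral and that one 1, so by
    independence the quotient sum cannot have value below 1. *)
Lemma absv_le_gamma_sum (a : 'I_f -> Qp) j :
  vp (a j) <= v (\sum_(i < f) a i *: gamma ^+ i).
Proof.
have [k _ kmax] := @arg_maxP _ R 'I_f j xpredT (fun i => vp (a i)) isT.
apply: (le_trans (kmax j isT)); rewrite leNgt; apply/negP => h.
have ak0 : a k != 0.
  by rewrite -(absv_gt0 vp_abs); apply: le_lt_trans h; apply: absv_ge0.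
have vk0 : 0 < vp (a k) by rewrite absv_gt0.
have : vp (a k / a k) < 1; last by rewrite divff// absv1// ltxx.
apply: (@gamma_indep (fun i => a i / a k)).
  move=> i; rewrite absvM// absvV// ler_pdivrMr// mul1r; exact: kmax.
rewrite (eq_bigr (fun i => (a k)^-1 *: (a i *: gamma ^+ i))).
  by rewrite -scaler_sumr ext_absvZ absvV// mulrC ltr_pdivrMr// mul1r.
by move=> i _; rewrite scalerA mulrC.
Qed.

(** The value of the sum is the largest value of a coefficient, hence already a value of [Qp]. *)
Lemma gamma_sum_value (a : 'I_f -> Qp) : \sum_(i < f) a i *: gamma ^+ i != 0 ->
  exists k : int, v (\sum_(i < f) a i *: gamma ^+ i) = p%:R ^ k.
Proof.
move=> s0; pose i0 := Ordinal f_gt0.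
have [k _ kmax] := @arg_maxP _ R 'I_f i0 xpredT (fun i => vp (a i)) isT.
have sE : v (\sum_(i < f) a i *: gamma ^+ i) = vp (a k).
  apply/eqP; rewrite eq_le absv_le_gamma_sum andbT.
  apply: (absv_sum_le_max v_abs v_ultra); first exact: absv_ge0.
  by move=> i _; rewrite ext_absvZ absv_gammaX mulr1; apply: kmax.
have ak0 : a k != 0 by rewrite -(absv_gt0 vp_abs) -sE absv_gt0.
by rewrite sE; apply: (padic_value p_prime Qp_padic).
Qed.

Hypothesis K_residue : residue_degree vp v {:K}%AS f.

(* Both the [gamma]-combinations and the given residue basis represent at most
   [p ^ f] residues, and the former represent that many. *)
Lemma gamma_residue x : v x <= 1 ->
  exists a : 'I_f -> Qp, v (x - \sum_(j < f) a j *: gamma ^+ j) < 1.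
Proof.
move=> x1; have [u [u1 u_gen _]] := K_residue.
have w1 j : v (u j) <= 1 by case: (u1 j).
have to_u y : v y <= 1 ->
    exists n : {ffun 'I_f -> 'I_p}, v (y - \sum_(j < f) (n j)%:R *: u j) < 1.
  move=> y1; have [a [a1 ya]] := u_gen y (memvf y) y1.
  have [n an] := digit_reduce a1 w1.
  by exists n; apply: (absvB_lt_trans v_ultra ya).
pose g (n : {ffun 'I_f -> 'I_p}) : K := \sum_(j < f) (n j)%:R *: gamma ^+ j.
have n1 (n : nat) : vp n%:R <= 1 by rewrite (padic_nat_le1 p_prime Qp_padic).
have g1 n : v (g n) <= 1.
  apply: (absv_sum_le_max v_abs v_ultra) => // j _.
  by rewrite ext_absvZ absv_gammaX mulr1.
have /choice[h hP] n := to_u _ (g1 n).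
have h_inj : injective h.
  move=> n n' nn'; apply/ffunP => j.
  have : v (g n - g n') < 1.
    by apply: (absvB_lt_trans v_ultra (hP n)); rewrite nn' absvBC.
  rewrite -sumrB; under eq_bigr do rewrite -scalerBl.
  move=> /(le_lt_trans (@absv_le_gamma_sum (fun j => (n j)%:R - (n' j)%:R) j)) nj.
  have D_std := standard_residue_system p (prime_gt0 p_prime).
  have [] : (n j : nat)%:Z = (n' j)%:Z; last exact: val_inj.
  by apply: (digit_inj p_prime Qp_padic D_std); rewrite // /standard_digits
    /mkset ltz_nat ltn_ord.
(* An injective self-map of a finite set is onto, so the [u]-digits of [x] are those of some
   [gamma]-combination. *)
have [h' _ h'K] := injF_bij h_inj.
have [n xn] := to_u x x1.
exists (fun j => (h' n j)%:R); apply: (absvB_lt_trans v_ultra xn).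
by rewrite absvBC//; have := hP (h' n); rewrite h'K.
Qed.

End Extension.

(** * The value group and integer parts in [K] *)

Section Floor.
Local Set Implicit Arguments.
Local Unset Strict Implicit.
Variables (R : realType) (p : nat) (Qp : fieldType) (vp : Qp -> R).
Hypothesis p_prime : prime p.
Hypothesis Qp_padic : is_padic_field p vp.
Variables (K : fieldExtType Qp) (v : K -> R).
Hypothesis v_ext : extends_absolute_value vp v.
Variables (e : nat) (beta : K).
Hypothesis K_ramification : ramification_index vp v {:K}%AS e.
Hypothesis beta_abs : v beta = p%:R `^ (e%:R^-1).

Let vp_abs := padic_absv Qp_padic.
Let vp_ultra := padic_ultra p_prime Qp_padic.
Let p_gt0 := padicR_gt0 R p_prime.
Let p_gt1 := padicR_gt1 R p_prime.
Let v_abs := ext_absv v_ext.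
Let v_ultra := ext_ultra p_prime Qp_padic v_ext.

Lemma ramification_index_gt0 : (0 < e)%N.
Proof.
have [t [_ H]] := K_ramification.
have [i _] := H 1 (memvf 1) (oner_neq0 K).
exact: leq_ltn_trans (ltn_ord i).
Qed.

Let e_gt0 := ramification_index_gt0.

Lemma absv_beta_gt0 : 0 < v beta. Proof. by rewrite beta_abs powR_gt0. Qed.
Let b_gt0 := absv_beta_gt0.

Lemma absv_betaX : v beta ^+ e = p%:R.
Proof.
rewrite beta_abs -powR_mulrn ?powR_ge0// -powRrM mulVf ?powRr1 ?ltW//.
by rewrite pnatr_eq0 -lt0n.
Qed.

Lemma absv_beta_gt1 : 1 < v beta.
Proof.
rewrite ltNge; apply/negP => b1.
by have := exprn_ile1 e (ltW b_gt0) b1; rewrite absv_betaX leNgt p_gt1.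
Qed.
Let b_gt1 := absv_beta_gt1.

Lemma absv_beta_value (i : nat) (k : int) :
  v beta ^+ i * p%:R ^ k = v beta ^ (i%:Z + e%:Z * k).
Proof. by rewrite expfzDr ?gt_eqF// -exprz_exp -!exprnP absv_betaX. Qed.

(** As powers of [v beta], the two sides have exponents whose remainders modulo [e] are [i] and
    [j]. *)
Lemma absv_beta_value_inj (i j : 'I_e) (k l : int) :
  v beta ^+ i * p%:R ^ k = v beta ^+ j * p%:R ^ l -> i = j.
Proof.
rewrite !absv_beta_value => /(ieexprIz b_gt0) ij.
have {}ij : i%:Z + e%:Z * k = j%:Z + e%:Z * l by apply: ij; rewrite gt_eqF.
apply/ord_inj; have [iE jE] := (ltn_ord i, ltn_ord j).
have : i%:Z - j%:Z = 0; last by lia.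
apply: (@dvdz_small e); last by lia.
by apply/dvdzP; exists (l - k); lia.
Qed.

Lemma betaX_neq0 i : beta ^+ i != 0.
Proof. by rewrite expf_neq0// -(absv_gt0 v_abs). Qed.

(* The powers of [beta] lie in distinct cosets of the value group of [Qp],
   hence exhaust the [e] cosets. *)
Lemma ext_value x : x != 0 ->
  exists (i : 'I_e) (k : int), v x = v beta ^+ i * p%:R ^ k.
Proof.
move=> x0; have [t [tP coset]] := K_ramification.
have repr y : y != 0 -> exists (i : 'I_e) (k : int), v y = v (t i) * p%:R ^ k.
  move=> y0; have [i [[a [a0 ya]] _]] := coset y (memvf y) y0.
  have [k ak] := padic_value p_prime Qp_padic a0.
  by exists i, k; rewrite ya ak.
have /choice[h hP] (i : 'I_e) := repr _ (betaX_neq0 i).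
have h_inj : injective h.
  move=> i j hij; have [[k ik] [l jl]] := (hP i, hP j).
  apply: (@absv_beta_value_inj i j l k).
  by rewrite -!(absvX v_abs) ik jl hij mulrAC.
have [h' _ h'K] := injF_bij h_inj.
have [s [k xk]] := repr x x0; have [l sl] := hP (h' s).
exists (h' s), (k - l); rewrite -(absvX v_abs) sl h'K xk -mulrA -expfzDr ?gt_eqF//.
by congr (_ * _ ^ _); lia.
Qed.

Lemma ext_value_beta x : x != 0 -> exists n : int, v x = v beta ^ n.
Proof.
by move=> /ext_value[i [k ->]]; exists (i%:Z + e%:Z * k); rewrite absv_beta_value.
Qed.

(** Supplies the gap [rho] for the continued fractions: every nonzero value is an integer power of
    [v beta]. *)
Lemma absv_beta_le x : 1 < v x -> v beta <= v x.
Proof.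
move=> x1; have x0 : x != 0 by rewrite -(absv_gt0 v_abs) (lt_trans _ x1).
have [n xn] := ext_value_beta x0; move: x1; rewrite xn.
by rewrite -(expr0z (v beta)) ltr_eXz2l// -[leLHS]expr1z ler_eXz2l//; lia.
Qed.

Lemma absv_lt_betaXS x n : v x < v beta ^+ n.+1 -> v x <= v beta ^+ n.
Proof.
have [->|x0] := eqVneq x 0; first by rewrite absv0// exprn_ge0// ltW.
have [k ->] := ext_value_beta x0.
by rewrite !exprnP ltr_eXz2l// ler_eXz2l//; lia.
Qed.

Variables (f : nat) (gamma : K).
Hypothesis K_residue : residue_degree vp v {:K}%AS f.
Hypothesis gamma_prim : (p ^ f - 1)%N.-primitive_root gamma.

Lemma residue_degree_gt0 : (0 < f)%N.
Proof.
have [u [_ H _]] := K_residue; rewrite lt0n; apply/eqP => f0.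
have v11 : v 1 <= 1 by rewrite absv1.
have [a [_]] := H 1 (memvf 1) v11.
rewrite big1 ?subr0 ?absv1 ?ltxx// => i.
by have := ltn_ord i; rewrite {2}f0.
Qed.

Let f_gt0 := residue_degree_gt0.

(** * Approximation by combinations of the [gamma ^+ j * beta ^+ i] *)

Definition combination (b : 'I_e -> 'I_f -> Qp) : K :=
  \sum_(i < e) \sum_(j < f) b i j *: (gamma ^+ j * beta ^+ i).

Lemma combinationE b :
  combination b = \sum_(i < e) (\sum_(j < f) b i j *: gamma ^+ j) * beta ^+ i.
Proof.
apply: eq_bigr => i _; rewrite mulr_suml.
by apply: eq_bigr => j _; rewrite scalerAl.
Qed.

Lemma combinationB b c :
  combination b - combination c = combination (fun i j => b i j - c i j).
Proof.
rewrite -sumrB; apply: eq_bigr => i _; rewrite -sumrB.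
by apply: eq_bigr => j _; rewrite scalerBl.
Qed.

(** Coefficients of value below 1 have value at most [p%:R^-1], which outweighs [v beta ^+ i < p%:R]
    for [i < e]. *)
Lemma combination_lt1 b : (forall i j, vp (b i j) < 1) -> v (combination b) < 1.
Proof.
move=> b1; apply: (absv_sum_lt v_abs v_ultra) => // i _.
apply: (absv_sum_lt v_abs v_ultra) => // j _.
rewrite (ext_absvZ v_ext) absvM// (absv_gammaX v_ext gamma_prim) mul1r absvX//.
have bp := padic_lt1 p_prime Qp_padic (b1 i j).
apply: (@le_lt_trans _ _ (p%:R^-1 * v beta ^+ i)).
  by rewrite ler_wpM2r// exprn_ge0// ltW.
by rewrite mulrC ltr_pdivrMr// mul1r -absv_betaX ltr_eXn2l.
Qed.

(** The inner [gamma]-sums have values in the value group of [Qp], so nonzero terms with different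
    [i] lie in different cosets and cannot cancel. *)
Lemma combination_coef_lt1 b : v (combination b) < 1 ->
  forall i j, vp (b i j) < 1.
Proof.
move=> b1 i j; pose l i := \sum_(j < f) b i j *: gamma ^+ j.
have lb1 : v (l i * beta ^+ i) < 1.
  apply: le_lt_trans b1; rewrite combinationE.
  apply: (@absv_le_sum_distinct _ _ _ v_abs v_ultra _ (fun i => l i * beta ^+ i)).
  move=> i1 i2; rewrite !mulf_eq0 !negb_or => /andP[l1 _] /andP[l2 _].
  have value := gamma_sum_value p_prime Qp_padic v_ext f_gt0 gamma_prim.
  have [[k1 lk1] [k2 lk2]] := (value _ l1, value _ l2).
  rewrite !(absvM v_abs) lk1 lk2 !(absvX v_abs) ![_ ^ _ * _]mulrC.
  exact: absv_beta_value_inj.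
apply: le_lt_trans lb1.
apply: (@le_trans _ _ (v (l i))).
  exact: (absv_le_gamma_sum p_prime Qp_padic v_ext f_gt0 gamma_prim).
by rewrite absvM// ler_peMr ?absv_ge0// absvX// exprn_ege1// ltW.
Qed.

Lemma leading_combination x : x != 0 -> exists b, v (x - combination b) < v x.
Proof.
move=> x0; have [i [k xk]] := ext_value x0.
(* The sign is due to [vp p%:R = p%:R^-1]. With it [y] has the value of [x], and the unit [x / y]
   can be approximated by powers of [gamma]. *)
pose s : Qp := p%:R ^ (- k).
have vs : vp s = p%:R ^ k.
  rewrite /s; case: (k) => n; rewrite ?NegzE ?opprK -?exprnN -?exprnP.
    exact: (padic_pX p_prime Qp_padic).
  by rewrite absvX// (padic_p p_prime Qp_padic) exprVn.
have s0 : s != 0 by rewrite -(absv_gt0 vp_abs) vs exprz_gt0.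
pose y := s *: beta ^+ i.
have vy : v y = v x by rewrite (ext_absvZ v_ext) absvX// vs xk mulrC.
have vx0 : 0 < v x by rewrite absv_gt0.
have y0 : y != 0 by rewrite -(absv_gt0 v_abs) vy.
have [|a xa] := gamma_residue p_prime Qp_padic v_ext f_gt0 gamma_prim K_residue
  (x := x / y).
  by rewrite absvM// absvV// vy divff// gt_eqF.
exists (fun i' j => if i' == i then s * a j else 0).
have -> : x - combination (fun i' j => if i' == i then s * a j else 0) =
    (x / y - \sum_(j < f) a j *: gamma ^+ j) * y.
  rewrite combinationE (bigD1 i)//= [X in _ - (_ + X)]big1 ?addr0.
    rewrite mulrBl divfK// eqxx; congr (_ - _); rewrite /y -scalerAr scalerAl.
    by congr (_ * _); rewrite scaler_sumr; apply: eq_bigr => j _; rewrite scalerA.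
  move=> j ji; rewrite big1 ?mul0r// => l _.
  by rewrite (negPf ji) scale0r.
by rewrite absvM// vy gtr_pMl.
Qed.

(** Values being powers of [v beta], removing a leading combination lowers the exponent by at least
    one. *)
Lemma combination_approx x : exists b, v (x - combination b) < 1.
Proof.
have comb0 : combination (fun _ _ => 0) = 0.
  by rewrite /combination big1// => i _; rewrite big1// => j _; rewrite scale0r.
have [n xn] : exists n, v x <= v beta ^+ n.
  have [->|x0] := eqVneq x 0; first by exists 0%N; rewrite absv0// expr0.
  have [k ->] := ext_value_beta x0; exists `|k|%N.
  by rewrite exprnP ler_eXz2l// abszE ler_norm.
elim: n x xn => [|n IHn] x xn.
  have [->|x0] := eqVneq x 0.
    by exists (fun _ _ => 0); rewrite comb0 subrr absv0.
  have [b xb] := leading_combination x0.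
  by exists b; apply: lt_le_trans xb xn.
have [->|x0] := eqVneq x 0.
  by exists (fun _ _ => 0); rewrite comb0 subrr absv0.
have [b xb] := leading_combination x0.
have [c xc] := IHn _ (absv_lt_betaXS (lt_le_trans xb xn)).
(* The sum of [c] and [b], written as a difference to fit [combinationB]. *)
exists (fun i j => c i j - (- b i j)).
rewrite -combinationB (_ : combination (fun i j => - b i j) = - combination b).
  by rewrite opprK opprD addrA addrAC.
by rewrite -[RHS]sub0r -comb0 combinationB; congr combination; apply/funext => i;
  apply/funext => j; rewrite sub0r.
Qed.

Variable D : set int.
Hypothesis D_residue : residue_system p D.

(** The coefficients of an approximating combination are replaced by their integer parts in [Qp], a
    change that [combination_lt1] controls. *)
Lemma partialZ_floor x : exists c, partialZ p D e f gamma beta c /\ v (x - c) < 1.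
Proof.
have [b xb] := combination_approx x.
have /choice[c cP] (ij : 'I_e * 'I_f) :=
  digitsX_approx p_prime Qp_padic D_residue (b ij.1 ij.2).
exists (combination (fun i j => c (i, j))); split.
  by exists (fun i j => c (i, j)); split=> // i j; case: (cP (i, j)).
apply: (absvB_lt_trans v_ultra xb); rewrite combinationB.
by apply: combination_lt1 => i j; case: (cP (i, j)).
Qed.

Lemma partialZ_separated c d : partialZ p D e f gamma beta c ->
  partialZ p D e f gamma beta d -> v (c - d) < 1 -> c = d.
Proof.
move=> [a [aX ->]] [b [bX ->]] cd.
have {}cd : v (combination (fun i j => a i j - b i j)) < 1.
  by rewrite -combinationB.
apply: eq_bigr => i _; apply: eq_bigr => j _; congr (_ *: _).
apply: (digitsX_separated p_prime Qp_padic D_residue (aX i j) (bX i j)).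
exact: combination_coef_lt1 cd i j.
Qed.

End Floor.

Theorem mainTheorem1
  (R : realType) (p : nat) (p_prime : prime p)
  (Qp : fieldType) (vp : Qp -> R) (Qp_padic : is_padic_field p vp)
  (K : fieldExtType Qp) (v : K -> R) (v_ext : extends_absolute_value vp v)
  (m e f : nat)
  (K_degree : \dim {:K} = m)
  (K_ramification : ramification_index vp v {:K}%AS e)
  (K_residue : residue_degree vp v {:K}%AS f)
  (L : {subfield K}) (L_unramified : unramified vp v L) (L_degree : \dim L = f)
  (gamma : K) (gamma_prim : (p ^ f - 1)%N.-primitive_root gamma)
  (L_gamma : (<<1; gamma>>%VS = L :> {vspace K}))
  (beta : K) (K_beta : (<<L; beta>>%VS = {:K}%VS))
  (beta_abs : v beta = p%:R `^ (e%:R^-1))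
  (D : set int)
  (D_digits : D = standard_digits p \/ (odd p /\ D = symmetric_digits p))
  (alpha : K) :
  exists! s : partial_quotients K,
    is_cfrac_expansion v (partialZ p D e f gamma beta)
      (partialZstar p D v e f gamma beta) alpha s.
Proof.
have D_residue : residue_system p D.
  case: D_digits => [->|[p_odd ->]]; last exact: symmetric_residue_system.
  exact/standard_residue_system/prime_gt0.
have v_abs := ext_absv v_ext.
have v_ultra := ext_ultra p_prime Qp_padic v_ext.
have floor := partialZ_floor p_prime Qp_padic v_ext K_ramification beta_abs
  K_residue gamma_prim D_residue.
have separated := partialZ_separated p_prime Qp_padic v_ext K_ramification
  beta_abs K_residue gamma_prim D_residue.
have b_gt1 := absv_beta_gt1 p_prime K_ramification beta_abs.
have b_le := absv_beta_le p_prime Qp_padic v_ext K_ramification beta_abs.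
exact: (expansion_exists_unique v_abs v_ultra floor separated b_gt1 b_le).
Qed.
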